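(* (1) For each natural number $n\ge1$, the monotone graph property $D_n$ is $\mathcal F_{[\omega]^2}$-hard on the vertex set $\omega$. (2) For each natural number $m\ge2$, the monotone graph property $C_m$ is $\mathcal F_{[\omega]^2}$-hard on the vertex set $\omega$.
   Context: $D_n$: ''the degree of each vertex is at least $n$''. $C_m$: ''every connected component has size at least $m$''. $\mathcal F_{[\omega]^2}=\{F\subseteq[\omega]^2:\exists W\subseteq\omega\text{ infinite with }[W]^2\subseteq F\}$. Game $\mathbb E_{\omega,R,\mathcal F}$ (for a property $R$ and an upward closed $\mathcal F\subseteq\mathcal P([\omega]^2)$): a pregraph on $\omega$ is $\langle\omega,E,N\rangle$ with $E,N\subseteq[\omega]^2$ disjoint (edges, nonedges; $P=E\cup N$ determined pairs); a graph $\langle\omega,E'\rangle$ extends it if $E\subseteq E'$ and $E'\cap N=\emptyset$. Alice and Bob build a transfinite sequence of pregraphs starting with $\langle\omega,\emptyset,\emptyset\rangle$, taking unions at limits; at successor steps Alice picks an undetermined pair and Bob declares it edge or nonedge. The game terminates at the first stage $\beta$ at which either every graph extending the current pregraph has $R$ or none does. Bob wins iff the set $P_\beta$ of determined pairs at termination belongs to $\mathcal F$. $R$ is $\mathcal F$-hard on $\omega$ iff Alice has no winning strategy in this game. *)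

(* Defs.v *)
From mathcomp Require Import all_boot finmap.
From mathcomp Require Import boolp classical_sets functions cardinality wochoice.
From Stdlib Require Import Relation_Operators.

Set Implicit Arguments.
Unset Strict Implicit.
Unset Printing Implicit Defensive.

Local Open Scope fset_scope.
Local Open Scope classical_set_scope.
Local Open Scope card_scope.

(** [W]^2, the set of two-element subsets of W; a graph on omega is given by
    its edge set E `<=` pairs setT. *)
Definition pairs (W : set nat) : set {fset nat} :=
  [set e | #|` e| = 2 /\ forall x, x \in e -> W x].

Definition adj (E : set {fset nat}) (x y : nat) : Prop := E [fset x; y].

Definition component (E : set {fset nat}) (x : nat) : set nat :=
  [set y | clos_refl_trans nat (adj E) x y].

Definition graph_property := set (set {fset nat}).

(** Degrees and component sizes are cardinals and may be infinite. *)
Definition D_ (n : nat) : graph_property :=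
  [set E | forall x, `I_n #<= [set y | adj E x y]].

Definition C_ (m : nat) : graph_property :=
  [set E | forall x, `I_m #<= component E x].

Definition F_omega : set (set {fset nat}) :=
  [set F | F `<=` pairs setT /\
           exists W : set nat, infinite_set W /\ pairs W `<=` F].

Record pregraph := Pregraph {
  edges : set {fset nat};
  nonedges : set {fset nat};
  edges_pairs : edges `<=` pairs setT;
  nonedges_pairs : nonedges `<=` pairs setT;
  edges_nonedges : edges `&` nonedges = set0 }.

Definition determined (G : pregraph) : set {fset nat} :=
  edges G `|` nonedges G.

Definition extends (E : set {fset nat}) (G : pregraph) : Prop :=
  [/\ E `<=` pairs setT, edges G `<=` E & E `&` nonedges G = set0].

Definition terminal (R : graph_property) (G : pregraph) : Prop :=
  (forall E, extends E G -> R E) \/ (forall E, extends E G -> ~ R E).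

Definition undetermined (G : pregraph) : set {fset nat} :=
  pairs setT `\` determined G.

(** Alice picks e at G and Bob's answer leads to G'. *)
Definition step (G : pregraph) (e : {fset nat}) (G' : pregraph) : Prop :=
  undetermined G e /\
  ((edges G' = edges G `|` [set e] /\ nonedges G' = nonedges G) \/
   (edges G' = edges G /\ nonedges G' = nonedges G `|` [set e])).

Section WellOrder.
Variables (I : Type) (le : rel I).

Definition slt (i j : I) : Prop := le i j /\ i <> j.
Definition is_zero (i : I) : Prop := forall j, le i j.
Definition is_succ (i j : I) : Prop := slt i j /\ forall k, slt i k -> le j k.
Definition is_limit (i : I) : Prop :=
  ~ is_zero i /\ ~ exists j, is_succ j i.

End WellOrder.

(** A (possibly unfinished) play.  The stages form a well-ordered type with a
    greatest element [final], i.e. they are the ordinals up to and including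
    some ordinal; the game has not terminated before [final]. *)
Record run (R : graph_property) := Run {
  stage : Type;
  stage_le : rel stage;
  stage_wo : well_order stage_le;
  final : stage;
  final_max : forall i, stage_le i final;
  pos : stage -> pregraph;
  pos_zero : forall i, is_zero stage_le i -> edges (pos i) = set0 /\
                                       nonedges (pos i) = set0;
  pos_succ : forall i j, is_succ stage_le i j -> exists e, step (pos i) e (pos j);
  pos_limit : forall i, is_limit stage_le i ->
    edges (pos i) = \bigcup_(j in [set j | slt stage_le j i]) edges (pos j) /\
    nonedges (pos i) = \bigcup_(j in [set j | slt stage_le j i]) nonedges (pos j);
  pos_nonterminal : forall i, slt stage_le i final -> ~ terminal R (pos i) }.

(** The sequence of positions of a run is strictly increasing, so the sequence
    up to stage i can be recovered from the set of its terms.  This gives a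
    type of histories that does not mention the names of the stages. *)
Definition history R (p : run R) (i : stage p) : set pregraph :=
  [set pos j | j in [set j | stage_le j i]].

Definition strategy := set pregraph -> {fset nat}.

Definition legal (R : graph_property) (s : strategy) : Prop :=
  forall p : run R, ~ terminal R (pos (final p)) ->
    undetermined (pos (final p)) (s (history (final p))).

Definition follows R (s : strategy) (p : run R) : Prop :=
  forall i j, is_succ (@stage_le R p) i j -> step (pos i) (s (history i)) (pos j).

(** Winning strategies of Alice: Bob wins a finished play iff the set of
    determined pairs belongs to F. *)
Definition winning (R : graph_property) (F : set (set {fset nat}))
    (s : strategy) : Prop :=
  legal R s /\
  forall p : run R, follows s p -> terminal R (pos (final p)) ->
    ~ F (determined (pos (final p))).

Definition hard (R : graph_property) (F : set (set {fset nat})) : Prop :=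
  ~ exists s, winning R F s.

Definition monotone (R : graph_property) : Prop :=
  forall E E', E `<=` E' -> E' `<=` pairs setT -> R E -> R E'.

Lemma D_monotone n : monotone (D_ n).
Proof.
move=> E E' sEE' _ DE x; apply: card_le_trans (DE x) _.
by apply: subset_card_le => y; exact: sEE'.
Qed.

Lemma C_monotone m : monotone (C_ m).
Proof.
move=> E E' sEE' _ CE x; apply: card_le_trans (CE x) _.
apply: subset_card_le => y; elim=> [a b /sEE'|a|a b c _ ab _ bc].
- exact: rt_step.
- exact: rt_refl.
- exact: rt_trans ab bc.
Qed.

Lemma F_omega_upward F F' :
  F `<=` F' -> F' `<=` pairs setT -> F_omega F -> F_omega F'.
Proof.
move=> sFF' sF' [_ [W [infW sWF]]]; split=> //.
by exists W; split=> //; exact: subset_trans sWF sFF'.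
Qed.

(* Main.v *)
(** For a pair {x, y} with y < x, Bob answers "nonedge" as long as more than n
    of the pairs {x, z} with z < x are not nonedges, and "edge" otherwise
    (n = 1 when playing for C_m).  As each x has only finitely many smaller
    vertices, the lower bound min(n, x) on the number of its non-nonedges
    downwards survives limit stages, so the graph of all non-nonedges always
    has the property and the game can only end with the edges already having
    it.  Then no vertex is isolated, so infinitely many vertices x have an edge
    downwards, and for each of those at most n pairs {x, z} with z < x are
    undetermined.  A graph on an infinite set with bounded down-degree has an
    infinite independent set, here an infinite W with all of [W]^2 determined.

    The play of Bob against a strategy of Alice is defined by transfinite
    recursion along a well-order of the power set of the set of pairs; it
    terminates since otherwise Alice's moves would inject this power set into
    the set of pairs. *)
Require Import Defs.
From mathcomp Require Import all_boot finmap zify.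
From mathcomp Require Import boolp classical_sets functions cardinality wochoice.
From Stdlib Require Import Relation_Operators Operators_Properties.

Set Implicit Arguments.
Unset Strict Implicit.
Unset Printing Implicit Defensive.

Local Open Scope fset_scope.
Local Open Scope classical_set_scope.
Local Open Scope card_scope.

(** * Infinite sets of naturals and independent sets in sparse graphs *)

Lemma infinite_unboundedP (W : set nat) :
  infinite_set W <-> forall M, exists2 x, W x & M < x.
Proof.
split=> [infW M|unbW finW].
  apply: contrapT => bW; apply: infW; apply: sub_finite_set (finite_II M.+1).
  by move=> x Wx /=; rewrite ltnS leqNgt; apply/negP => Mx; apply: bW; exists x.
have /finite_seqP[r Wr] := finW.
have [x] := unbW (\max_(i <- r) i); rewrite Wr /= => xr.
by rewrite ltnNge (bigmaxn_sup_seq _ xr).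
Qed.

Lemma uniq_card_le (A : set nat) (r : seq nat) (n : nat) :
  uniq r -> n <= size r -> (forall x, x \in r -> A x) -> `I_n #<= A.
Proof.
move=> ur nr rA; apply/pcard_leP/injfunPex.
exists (nth 0 r) => [i /= ni|i j]; first by apply/rA/mem_nth/(leq_trans ni).
rewrite !inE /= => ni nj /eqP.
by rewrite nth_uniq ?(leq_trans ni) ?(leq_trans nj) // => /eqP.
Qed.

(** Induction on [d]. Take a maximal independent subset of [W]. If it is finite, every vertex of [W]
    beyond it has a neighbour in it, so restricting [W] to these vertices lowers the bound on the
    down-degree by one. *)
Lemma sparse_independent (d : nat) (U : nat -> nat -> Prop) (W : set nat) :
    infinite_set W ->
    (forall x, W x -> count (fun y => `[< W y /\ U x y >]) (iota 0 x) <= d) ->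
  exists V : set nat, [/\ infinite_set V, V `<=` W &
    forall x y, V x -> V y -> y < x -> ~ U x y].
Proof.
elim: d W => [|d IHd] W infW degW.
  exists W; split=> // x y Wx Wy yx Uxy; move: (degW x Wx).
  rewrite leqNgt -has_count => /negP; apply; apply/hasP; exists y.
    by rewrite mem_iota.
  exact/asboolP.
pose indep (V : set nat) :=
  V `<=` W /\ forall x y, V x -> V y -> y < x -> ~ U x y.
have [|V [[VW iV] maxV]] := @Zorn_bigcup nat indep.
  move=> F Find totF; split=> [x [X FX Xx]|x y [X FX Xx] [Y FY Yy]].
    by have [XW _] := Find X FX; exact: XW.
  have [XY|YX] := totF X Y FX FY.
    by have [_ iY] := Find Y FY; apply: iY => //; exact: XY.
  by have [_ iX] := Find X FX; apply: iX => //; exact: YX.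
have [finV|infV] := pselect (finite_set V); last by exists V.
have [M VM] : exists M, forall x, V x -> x <= M.
  apply: contrapT => unbV; have /infinite_unboundedP : forall M, exists2 x, V x & M < x.
    move=> M; apply: contrapT => bV; apply: unbV; exists M => x Vx.
    by rewrite leqNgt; apply/negP => Mx; apply: bV; exists x.
  by apply.
pose W' : set nat := [set x | W x /\ M < x].
have [|x [Wx Mx]|V' [infV' V'W' iV']] := IHd W'.
- apply/infinite_unboundedP => m.
  have [x Wx mx] := (infinite_unboundedP W).1 infW (maxn m M).
  by exists x; [split=> //|]; lia.
(* Otherwise [x], which exceeds every element of [V], could be added to [V], against maximality. *)
- have [y Vy Uxy] : exists2 y, V y & U x y.
    apply: contrapT => nU; apply: (maxV (V `|` [set x])).
      split; first by left.
      move=> /(_ x (or_intror erefl)) /VM; lia.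
    split=> [z [/VW//|->//]|a b].
    move=> [Va|->] [Vb|->]; rewrite ?ltnn //.
    - exact: iV.
    - by move=> xa; move: (VM _ Va); lia.
    - by move=> bx Uxb; apply: nU; exists b.
  rewrite -ltnS; apply: leq_trans (degW x Wx).
  (* [Q] counts neighbours in [W] and [P] those in [W']. The vertex [y] is at most [M], hence
     counted by [Q] only, which makes the inequality strict. *)
  set P := (X in count X _ < _); set Q := (X in _ < count X _).
  have -> : count P (iota 0 x) = count (predI P (predC1 y)) (iota 0 x).
    apply: eq_count => z /=; case: eqP => [->|]; rewrite ?andbT // andbF.
    by apply/asboolP => -[[_ /=]]; move: (VM _ Vy); lia.
  have yx : y \in iota 0 x by rewrite mem_iota; move: (VM _ Vy); lia.
  rewrite (@leq_trans (count (predU (predI P (predC1 y)) (pred1 y)) (iota 0 x))) //.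
    have := count_predUI (predI P (predC1 y)) (pred1 y) (iota 0 x).
    rewrite (count_uniq_mem _ (iota_uniq _ _)) yx.
    rewrite [count (predI _ (pred1 y)) _](_ : _ = 0); first lia.
    by apply/eqP; rewrite -leqn0 leqNgt -has_count; apply/hasP => -[z _ /=]; case: eqP; rewrite ?andbF.
  apply: sub_count => z /=; case: eqP => [-> _|_].
    by apply/asboolP; split=> //; exact: VW.
  by rewrite andbT orbF => /asboolP[[Wz _] Uz]; apply/asboolP.
- by exists V'; split=> // z /V'W'[].
Qed.

(** * Unordered pairs and the construction of pregraphs *)

Lemma ltn_pair_inj (x y a b : nat) :
  y < x -> b < a -> [fset x; y] = [fset a; b] -> x = a /\ y = b.
Proof.
move=> yx ba /fsetP eqE.
have := eqE x; have := eqE y; have := eqE a; have := eqE b.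
rewrite !inE !eqxx ?orbT ?orTb /=; lia.
Qed.

Lemma pairsP (e : {fset nat}) :
  pairs setT e <-> exists x y, y < x /\ e = [fset x; y].
Proof.
split=> [[e2 _]|[x [y [yx ->]]]]; last first.
  by split=> //; rewrite cardfs2; rewrite gtn_eqF.
have [r [ur r2 er]] : exists r : seq nat, [/\ uniq r, size r = 2 & e =i r].
  by exists (enum_fset e); split=> //; exact: fset_uniq.
case: r ur r2 er => [|x [|y []]] //=; rewrite inE andbT => nxy _ er.
have -> : e = [fset x; y] by apply/fsetP => z; rewrite er !inE.
have [yx|xy|xy] := ltngtP y x; first by exists x, y.
  by exists y, x; rewrite fsetUC.
by rewrite xy eqxx in nxy.
Qed.

Definition mkpre_edges (E : set {fset nat}) := E `&` pairs setT.
Definition mkpre_nonedges (E N : set {fset nat}) :=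
  (N `&` pairs setT) `\` mkpre_edges E.

(* Truncates arbitrary sets to a pregraph; on legitimate data it changes
   nothing (mkpreE), and it makes the transfinite recursion below total. *)
Definition mkpre (E N : set {fset nat}) : pregraph :=
  @Pregraph (mkpre_edges E) (mkpre_nonedges E N)
    (@subIsetr _ E (pairs setT))
    (fun e h => (h.1).2) (setDIK _ _).

Lemma mkpreE (E N : set {fset nat}) :
    E `<=` pairs setT -> N `<=` pairs setT -> E `&` N = set0 ->
  edges (mkpre E N) = E /\ nonedges (mkpre E N) = N.
Proof.
move=> EP NP EN0; rewrite /= /mkpre_nonedges /mkpre_edges.
rewrite (setIidl EP) (setIidl NP); split=> //.
by apply/setDidl; rewrite setIC.
Qed.

(** * Counting the non-nonedges towards smaller vertices *)

Definition down (N : set {fset nat}) (x : nat) : nat :=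
  count (fun z => ~~ `[< N [fset x; z] >]) (iota 0 x).

Lemma down_set0 (x : nat) : down set0 x = x.
Proof.
have /eq_count eqT : (fun z => ~~ `[< set0 [fset x; z] >]) =1 predT.
  by move=> z; apply/asboolP => -[].
by rewrite /down eqT count_predT size_iota.
Qed.

Lemma down_anti (N N' : set {fset nat}) (x : nat) :
  N `<=` N' -> down N' x <= down N x.
Proof.
move=> NN'; apply: sub_count => z; apply: contra => /asboolP Nz.
by apply/asboolP; exact: NN'.
Qed.

Lemma sub_in_count (S : eqType) (p q : pred S) (r : seq S) :
  {in r, subpred p q} -> count p r <= count q r.
Proof.
elim: r => //= x r IHr pq; apply: leq_add.
  by have := pq x (mem_head _ _); case: (p x) => // ->.
by apply: IHr => y ry; apply: pq; rewrite inE ry orbT.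
Qed.

(** A pair is counted only at its larger endpoint, so a new nonedge costs at most one, and only at
    [a]. *)
Lemma down_setU1 (N : set {fset nat}) (a b x : nat) : b < a ->
  down N x <= down (N `|` [set [fset a; b]]) x + (x == a).
Proof.
move=> ba; case: eqP => [->|xa].
  have <- : count (pred1 b) (iota 0 a) = true.
    by rewrite (count_uniq_mem _ (iota_uniq _ _)) mem_iota ba.
  rewrite /down -count_predUI; apply: leq_trans (leq_addr _ _).
  apply: sub_in_count => z; rewrite mem_iota => /= za /asboolP Nz.
  case: eqP => [->|zb]; first by rewrite orbT.
  rewrite orbF; apply/asboolP => -[//|/(ltn_pair_inj za ba)[_ //]].
rewrite addn0; apply: sub_in_count => z; rewrite mem_iota => /= zx /asboolP Nz.
by apply/asboolP => -[//|/(ltn_pair_inj zx ba)[]].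
Qed.

(** * Bob's answers and their invariant *)

Section Bob.
Variable n : nat.

Definition accepts (N : set {fset nat}) (e : {fset nat}) : Prop :=
  exists x y, [/\ y < x, e = [fset x; y] & down N x <= n].

(** A determined pair leaves the position unchanged; this makes the answer total, so the recursion
    can be set up before Alice's moves are known to be legal. *)
Definition bob (G : pregraph) (e : {fset nat}) : pregraph :=
  if pselect (undetermined G e) then
    if pselect (accepts (nonedges G) e)
    then mkpre (edges G `|` [set e]) (nonedges G)
    else mkpre (edges G) (nonedges G `|` [set e])
  else G.

Lemma bobE (G : pregraph) (e : {fset nat}) : undetermined G e ->
  if pselect (accepts (nonedges G) e)
  then edges (bob G e) = edges G `|` [set e] /\
       nonedges (bob G e) = nonedges G
  else edges (bob G e) = edges G /\
       nonedges (bob G e) = nonedges G `|` [set e].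
Proof.
move=> ue; rewrite /bob; case: (pselect (undetermined G e)) => // -[eP nd].
have nEe : ~ edges G e by move=> Ee; apply: nd; left.
have nNe : ~ nonedges G e by move=> Ne; apply: nd; right.
have eP1 : [set e] `<=` pairs setT by move=> _ ->.
case: pselect => ? /=; apply: mkpreE.
- by move=> f [/edges_pairs|/eP1].
- exact: nonedges_pairs.
- rewrite setIUl edges_nonedges set0U.
  by apply/disjoints_subset => _ ->.
- exact: edges_pairs.
- by move=> f [/nonedges_pairs|/eP1].
- rewrite setIUr edges_nonedges set0U setIC.
  by apply/disjoints_subset => _ ->.
Qed.

Lemma bob_step (G : pregraph) (e : {fset nat}) :
  undetermined G e -> step G e (bob G e).
Proof.
by move=> ue; split=> //; have := bobE ue; case: pselect => ? ?; [left|right].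
Qed.

Lemma bob_sub (G : pregraph) (e : {fset nat}) :
  edges G `<=` edges (bob G e) /\ nonedges G `<=` nonedges (bob G e).
Proof.
have [ue|nu] := pselect (undetermined G e); last first.
  by rewrite /bob; case: (pselect (undetermined G e)) => // ?; split.
have [_ [[-> ->]|[-> ->]]] := bob_step ue; split=> // f; by left.
Qed.

(** The first clause keeps the property attainable; the second leaves few undetermined pairs below a
    vertex that has an edge downwards. *)
Definition good (G : pregraph) : Prop :=
  (forall x, minn n x <= down (nonedges G) x) /\
  (forall x y, y < x -> edges G [fset x; y] -> down (nonedges G) x <= n).

(** An accepted pair keeps all counts, and acceptance is exactly the bound required of a new edge. A
    rejected pair lowers one count by one, from a value above [n], so it stays at least [n]; upper
    bounds survive because counts only fall. *)
Lemma bob_good (G : pregraph) (e : {fset nat}) : good G -> good (bob G e).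
Proof.
move=> gG; have [ue|nu] := pselect (undetermined G e); last first.
  by rewrite /bob; case: (pselect (undetermined G e)).
have [lowG highG] := gG; have := bobE ue; case: pselect => [acc|nacc] [eE eN].
  split; rewrite eN // eE => x y yx [|xy]; first exact: highG.
  have [a [b [ba eab dn]]] := acc.
  by have [->] := ltn_pair_inj yx ba (etrans xy eab).
have [a [b [ba eab]]] := (pairsP e).1 ue.1.
have dna : n < down (nonedges G) a.
  by rewrite ltnNge; apply/negP => dn; apply: nacc; exists a, b.
split; rewrite eN.
  move=> x; have := down_setU1 (nonedges G) x ba; rewrite -eab.
  have := lowG x; case: eqP => [->|_]; last first.
    by rewrite addn0; exact: leq_trans.
  rewrite addn1 => _ /(leq_trans dna); rewrite ltnS; apply: leq_trans.
  exact: geq_minl.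
rewrite eE => x y yx /(highG _ _ yx); apply: leq_trans.
by apply: down_anti => f; left.
Qed.

End Bob.

(** * Order facts derived from existence and uniqueness of minima *)

Section WellOrderTheory.
Variables (T : eqType) (le : rel T) (le_wo : well_order le).

Lemma wo_minimum (P : T -> Prop) : (exists x, P x) ->
  exists2 m, P m & forall x, P x -> le m x.
Proof.
move=> [x Px]; have [|m [[/asboolP Pm lem] _]] := le_wo (A := fun x => `[< P x >]).
  by exists x; exact/asboolP.
by exists m => // y Py; apply: lem; exact/asboolP.
Qed.

Lemma wo_total : total le.
Proof.
move=> x y; have [|m [->|->] lem] := @wo_minimum (fun z => z = x \/ z = y).
- by exists x; left.
- by rewrite lem //; right.
- by rewrite orbC lem //; left.
Qed.

Lemma wo_refl : reflexive le.
Proof. by move=> x; have := wo_total x x; rewrite orbb. Qed.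

(** Both elements would be minima of the set formed by [x] and [y], and minima are unique. *)
Lemma wo_anti x y : le x y -> le y x -> x = y.
Proof.
move=> xy yx.
have [|m [_ uniqm]] := le_wo (A := pred2 x y); first by exists x; rewrite inE eqxx.
have min_xy z : z = x \/ z = y -> minimum_of le (pred2 x y) z.
  move=> zxy; split; first by case: zxy => ->; rewrite inE eqxx ?orbT.
  by move=> t; rewrite inE => /orP[] /eqP ->; case: zxy => ->; rewrite ?wo_refl.
by rewrite -(uniqm x) ?(uniqm y) //; apply: min_xy; [right|left].
Qed.

Lemma wo_trans : transitive le.
Proof.
move=> y x z xy yz.
have [|m mxyz lem] := @wo_minimum (fun t => [\/ t = x, t = y | t = z]).
  by exists x; apply: Or31.
case: mxyz lem => -> lem; first by apply: lem; apply: Or33.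
- by rewrite (wo_anti xy (lem x _)) //; apply: Or31.
- by rewrite -(wo_anti yz (lem y _)) //; apply: Or32.
Qed.

Lemma slt_irr x : ~ slt le x x.
Proof. by case. Qed.

Lemma le_slt_trans x y z : le x y -> slt le y z -> slt le x z.
Proof.
move=> xy [yz nyz]; split; first exact: wo_trans xy yz.
by move=> xz; apply: nyz; apply: wo_anti => //; rewrite -xz.
Qed.

Lemma slt_le_trans x y z : slt le x y -> le y z -> slt le x z.
Proof.
move=> [xy nxy] yz; split; first exact: wo_trans xy yz.
by move=> xz; apply: nxy; apply: wo_anti => //; rewrite xz.
Qed.

Lemma le_slt_total x y : le x y \/ slt le y x.
Proof.
have [->|nxy] := eqVneq x y; first by left; exact: wo_refl.
have /orP[|yx] := wo_total x y; [by left|right; split=> // yx'].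
by rewrite yx' eqxx in nxy.
Qed.

Lemma le_eq_slt x y : le x y -> x = y \/ slt le x y.
Proof.
by move=> xy; have [->|/eqP nxy] := eqVneq x y; [left|right].
Qed.

Lemma slt_wf : well_founded (slt le).
Proof.
move=> x; apply: contrapT => nAcc.
have [|m nAccm minm] := @wo_minimum (fun z => ~ Acc (slt le) z); first by exists x.
apply: nAccm; constructor => y ym; apply: contrapT => /minm my.
exact: slt_irr (le_slt_trans my ym).
Qed.

End WellOrderTheory.

(** * The play against a strategy, by transfinite recursion *)

Section Play.
Variables (T : eqType) (le : rel T) (le_wo : well_order le).
Variables (R : graph_property) (s : strategy) (n : nat).
Hypothesis s_legal : legal R s.

(** Taking the union of Bob's answers at all earlier stages treats zero, successor and limit stages
    by one formula. The argument of [s] is the history up to [j]. *)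
Definition play_rec (i : T) (f : forall j, slt le j i -> pregraph) : pregraph :=
  let next j (h : slt le j i) :=
    bob n (f j h) (s [set G | exists k (hk : slt le k i), le k j /\ f k hk = G])
  in mkpre [set e | exists j (h : slt le j i), edges (next j h) e]
           [set e | exists j (h : slt le j i), nonedges (next j h) e].

Definition play : T -> pregraph := Fix (slt_wf le_wo) (fun=> pregraph) play_rec.

Definition past (i : T) : set pregraph := [set play j | j in [set j | le j i]].

Definition next (i : T) : pregraph := bob n (play i) (s (past i)).

Lemma playE i :
  play i = mkpre (\bigcup_(j in [set j | slt le j i]) edges (next j))
                 (\bigcup_(j in [set j | slt le j i]) nonedges (next j)).
Proof.
rewrite /play Fix_eq; last first.
  move=> k f g fg; congr play_rec.
  by apply: functional_extensionality_dep => j; apply: funext => h; exact: fg.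
rewrite -/play /play_rec.
have pastE j : slt le j i ->
    [set G | exists k (hk : slt le k i), le k j /\ play k = G] = past j.
  move=> ji; apply/seteqP; split=> [G [k [_ [kj <-]]]|G [k kj <-]].
    by exists k.
  by exists k, (le_slt_trans le_wo kj ji).
congr mkpre; apply/seteqP; split=> e.
- by move=> [j [h]]; rewrite pastE // => ?; exists j.
- by move=> [j h ?]; exists j, h; rewrite pastE.
- by move=> [j [h]]; rewrite pastE // => ?; exists j.
- by move=> [j h ?]; exists j, h; rewrite pastE.
Qed.

Lemma play_next_sub i :
  edges (play i) `<=` edges (next i) /\ nonedges (play i) `<=` nonedges (next i).
Proof. exact: bob_sub. Qed.

(** The truncation in [mkpre] is harmless: an edge and a nonedge answered at two stages would both
    persist to the later one, where by induction positions grow, and a pregraph keeps them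
    disjoint. *)
Lemma play_bigcup i :
  edges (play i) = \bigcup_(j in [set j | slt le j i]) edges (next j) /\
  nonedges (play i) = \bigcup_(j in [set j | slt le j i]) nonedges (next j).
Proof.
elim/(well_founded_ind (slt_wf le_wo)): i => i IHi; rewrite playE; apply: mkpreE.
- by move=> e [j _]; exact: edges_pairs.
- by move=> e [j _]; exact: nonedges_pairs.
apply/disjoints_subset => e [j /= ji Ee] [k /= ki Ne].
have no_both l : ~ (edges (next l) e /\ nonedges (next l) e).
  by move=> EN; have : set0 e; [rewrite -(edges_nonedges (next l))|].
have [/le_eq_slt[jk|jk]|kj] := le_slt_total le_wo j k.
- by apply: (no_both k); rewrite -{1}jk.
- apply: (no_both k); split=> //; apply: (play_next_sub k).1.
  by rewrite (IHi k ki).1; exists j.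
- apply: (no_both j); split=> //; apply: (play_next_sub j).2.
  by rewrite (IHi j ji).2; exists k.
Qed.

Lemma next_play_sub i j : slt le i j ->
  edges (next i) `<=` edges (play j) /\ nonedges (next i) `<=` nonedges (play j).
Proof. by move=> ij; rewrite !(play_bigcup j).1 !(play_bigcup j).2; split=> e ?; exists i. Qed.

Lemma play_zero i : (forall j, ~ slt le j i) ->
  edges (play i) = set0 /\ nonedges (play i) = set0.
Proof.
by move=> i0; have [-> ->] := play_bigcup i; split; apply/seteqP; split=> // e [j /i0].
Qed.

Lemma play_succ i j : slt le i j -> (forall k, slt le k j -> le k i) ->
  edges (play j) = edges (next i) /\ nonedges (play j) = nonedges (next i).
Proof.
move=> ij ji; have [subE subN] := next_play_sub ij.
split; apply/seteqP; split=> // e.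
  rewrite (play_bigcup j).1 => -[k /= /ji /le_eq_slt[->//|ki] Ee].
  exact/(play_next_sub i).1/(next_play_sub ki).1.
rewrite (play_bigcup j).2 => -[k /= /ji /le_eq_slt[->//|ki] Ee].
exact/(play_next_sub i).2/(next_play_sub ki).2.
Qed.

(** The answer given at [j] is already part of the position at any stage strictly between [j] and
    [i]. *)
Lemma play_limit i : (forall j, slt le j i -> exists2 k, slt le j k & slt le k i) ->
  edges (play i) = \bigcup_(j in [set j | slt le j i]) edges (play j) /\
  nonedges (play i) = \bigcup_(j in [set j | slt le j i]) nonedges (play j).
Proof.
move=> lim; split; apply/seteqP; split=> e.
- rewrite {1}(play_bigcup i).1 => -[j /= /lim[k jk ki] Ee].
  by exists k => //; exact: (next_play_sub jk).1.
- move=> [j /= ji Ee]; exact/(next_play_sub ji).1/(play_next_sub j).1.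
- rewrite {1}(play_bigcup i).2 => -[j /= /lim[k jk ki] Ee].
  by exists k => //; exact: (next_play_sub jk).2.
- move=> [j /= ji Ee]; exact/(next_play_sub ji).2/(play_next_sub j).2.
Qed.

Lemma play_good i : good n (play i).
Proof.
elim/(well_founded_ind (slt_wf le_wo)): i => i IHi.
have goodn j : slt le j i -> good n (next j) by move=> /IHi; exact: bob_good.
have [eE eN] := play_bigcup i; split=> [x|x y yx].
  have [[j0 j0i]|ni] := pselect (exists j, slt le j i); last first.
    rewrite (play_zero _).2; last by move=> j ji; apply: ni; exists j.
    by rewrite down_set0 geq_minr.
  (* Only finitely many pairs lie below x, so some earlier stage already
     has all of their nonedges. *)
  have [j ji stab] : exists2 j, slt le j i & forall z, z \in iota 0 x ->
      nonedges (play i) [fset x; z] -> nonedges (next j) [fset x; z].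
    elim: (iota 0 x) => [|z r [j ji IHr]]; first by exists j0.
    have [|nNz] := pselect (nonedges (play i) [fset x; z]); last first.
      by exists j => // t; rewrite inE => /orP[/eqP -> //|]; exact: IHr.
    rewrite {1}eN => -[k /= ki Nz].
    have mono a b : le a b -> nonedges (next a) `<=` nonedges (next b).
      move=> /le_eq_slt[->//|ab] f /(next_play_sub ab).2.
      exact: (play_next_sub b).2.
    have /orP[jk|kj] := wo_total le_wo j k.
      exists k => // t; rewrite inE => /orP[/eqP -> //|tr Nt].
      exact/(mono _ _ jk)/IHr.
    exists j => // t; rewrite inE => /orP[/eqP -> _|]; last exact: IHr.
    exact: mono kj _ Nz.
  apply: leq_trans ((goodn j ji).1 x) _; apply: sub_in_count => z xz.
  by apply: contra => /asboolP /(stab _ xz) ?; apply/asboolP.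
(* An edge stems from some earlier answer, whose upper bound persists as nonedges accumulate. *)
rewrite {1}eE => -[j /= ji /((goodn j ji).2 _ _ yx)]; apply: leq_trans.
exact/down_anti/(next_play_sub ji).2.
Qed.

(** * Initial segments of the play as runs of the game *)

Section RunUpTo.
Variable i : T.
Hypothesis legal_before : forall j, slt le j i -> undetermined (play j) (s (past j)).
Hypothesis nonterminal_before : forall j, slt le j i -> ~ terminal R (play j).

Let stage := {j | le j i}.
Let stage_le : rel stage := fun j k => le (val j) (val k).

Let sltE (j k : stage) : slt stage_le j k <-> slt le (val j) (val k).
Proof.
split=> -[jk njk]; split=> //; first by move=> /val_inj.
by move=> jk'; apply: njk; rewrite jk'.
Qed.

Let stage_wo : well_order stage_le.
Proof.
apply: antisymmetric_well_order.
  by move=> j k /andP[jk kj]; apply: val_inj; exact: wo_anti le_wo _ _ jk kj.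
move=> A [x Ax]; have [|m [y <- Ay] minm] :=
  @wo_minimum _ _ le_wo (fun z => exists2 y : stage, val y = z & y \in A).
  by exists (val x), x.
by exists y; split=> // z Az; apply: minm; exists z.
Qed.

Let final : stage := exist _ i (wo_refl le_wo i).

Let final_max (j : stage) : stage_le j final.
Proof. exact: valP j. Qed.

Let below (j : stage) (k : T) : slt le k (val j) -> {k' : stage | val k' = k}.
Proof.
move=> [kj _]; have ki : le k i by apply: wo_trans le_wo _ _ _ kj (valP j).
by exists (exist _ k ki).
Qed.

Let pos (j : stage) := play (val j).

Let pos_zero j : is_zero stage_le j ->
  edges (pos j) = set0 /\ nonedges (pos j) = set0.
Proof.
move=> j0; apply: play_zero => k /[dup] kj /below [k' kE].
apply: (slt_irr (le := le) (x := k)); apply: slt_le_trans kj _ => //.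
by rewrite -kE; exact: j0.
Qed.

Let succ_step j k : is_succ stage_le j k -> step (pos j) (s (past (val j))) (pos k).
Proof.
move=> [/sltE jk kmin]; have [eE eN] : edges (pos k) = edges (next (val j)) /\
    nonedges (pos k) = nonedges (next (val j)).
  apply: play_succ => // l /[dup] lk /below [l' lE].
  have [//|] := le_slt_total le_wo l (val j).
  rewrite -lE => /sltE /kmin kl; rewrite -lE in lk.
  by have := slt_irr (le_slt_trans le_wo kl lk).
have ji := slt_le_trans le_wo jk (valP k).
have [undj out] := bob_step n (legal_before ji).
by split=> //; rewrite eE eN.
Qed.

Let pos_succ j k : is_succ stage_le j k -> exists e, step (pos j) e (pos k).
Proof. by move=> /succ_step; exists (s (past (val j))). Qed.

Let pos_limit j : is_limit stage_le j ->
  edges (pos j) = \bigcup_(k in [set k | slt stage_le k j]) edges (pos k) /\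
  nonedges (pos j) = \bigcup_(k in [set k | slt stage_le k j]) nonedges (pos k).
Proof.
move=> [_ nsucc].
have reindex (F : T -> set {fset nat}) :
    \bigcup_(k in [set k | slt le k (val j)]) F k =
    \bigcup_(k in [set k | slt stage_le k j]) F (val k).
  apply/seteqP; split=> e [k /= kj Fk]; last first.
    by exists (val k) => //; exact/sltE.
  have [k' kE] := below kj; exists k'; last by rewrite kE.
  by apply/sltE; rewrite kE.
have [|eE eN] := @play_limit (val j); last by rewrite /pos eE eN !reindex.
move=> k kj; have [k' kE] := below kj; apply: contrapT => nolim; apply: nsucc.
exists k'; split=> [|l /sltE k'l]; first by apply/sltE; rewrite kE.
have [//|lj] := le_slt_total le_wo (val j) (val l).
by exfalso; apply: nolim; exists (val l) => //; rewrite -kE.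
Qed.

Let pos_nonterminal j : slt stage_le j final -> ~ terminal R (pos j).
Proof. by move=> /sltE; exact: nonterminal_before. Qed.

Definition run_upto : run R :=
  Run stage_wo final_max pos_zero pos_succ pos_limit pos_nonterminal.

(** Histories are sets of positions, so passing to the subtype of stages leaves no trace in them. *)
Lemma history_upto (j : Defs.stage run_upto) : history j = past (val j).
Proof.
apply/seteqP; split=> [G [k kj <-]|G [k kj <-]]; first by exists (val k).
have ki : le k i by apply: wo_trans le_wo _ _ _ kj (valP j).
by exists (exist _ k ki).
Qed.

Lemma follows_upto : follows s run_upto.
Proof. by move=> j k /succ_step; rewrite history_upto. Qed.

End RunUpTo.

(** Legality of [s] speaks of runs only, and building the run up to [i] needs legal moves before
    [i]; induction on [i] resolves this circle. *)
Lemma move_undetermined i :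
  (forall j, le j i -> ~ terminal R (play j)) ->
  undetermined (play i) (s (past i)).
Proof.
elim/(well_founded_ind (slt_wf le_wo)): i => i IHi nti.
have before j : slt le j i -> undetermined (play j) (s (past j)).
  move=> ji; apply: IHi => // k kj; apply: nti.
  by have [] := le_slt_trans le_wo kj ji.
have ntb j : slt le j i -> ~ terminal R (play j) by case=> ji _; exact: nti.
have := s_legal (p := run_upto before ntb) (nti i (wo_refl le_wo i)).
by rewrite history_upto.
Qed.

(** A pair chosen at one stage is determined at all later ones, where it cannot be chosen again. *)
Lemma moves_inj : (forall i, ~ terminal R (play i)) ->
  injective (fun i => s (past i)).
Proof.
move=> nt.
have neq i j : slt le i j -> s (past i) <> s (past j).
  move=> ij eq_ij.
  have [_ nd] := move_undetermined (fun k _ => nt k) (i := j).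
  have [_ out] := bob_step n (move_undetermined (fun k _ => nt k) (i := i)).
  have [subE subN] := next_play_sub ij; apply: nd; rewrite -eq_ij.
  case: out; rewrite -/(next i) => -[eE eN].
    by left; apply: subE; rewrite eE; right.
  by right; apply: subN; rewrite eN; right.
move=> i j eq_ij; have [/le_eq_slt[//|ij]|ji] := le_slt_total le_wo i j.
  by have := neq _ _ ij eq_ij.
by have := neq _ _ ji (esym eq_ij).
Qed.

(** The play is cut at its least terminal stage. *)
Lemma terminal_run : (exists i, terminal R (play i)) ->
  exists p : run R, [/\ follows s p, terminal R (pos (final p)) &
                        good n (pos (final p))].
Proof.
move=> /(wo_minimum le_wo)[i ti mini].
have ntb j : slt le j i -> ~ terminal R (play j).
  by move=> ji /mini ij; exact: slt_irr (le_slt_trans le_wo ij ji).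
have before j : slt le j i -> undetermined (play j) (s (past j)).
  move=> ji; apply: move_undetermined => k kj; apply: ntb.
  exact: le_slt_trans kj ji.
exists (run_upto before ntb); split=> //; first exact: follows_upto.
exact: play_good.
Qed.

End Play.

(** * Cantor's diagonal argument and a common criterion for hardness *)

Lemma no_injective_set (A : Type) (f : set A -> A) : ~ injective f.
Proof.
move=> inj_f; pose D : set A := [set a | exists2 X, f X = a & ~ X a].
have nD : ~ D (f D) by move=> /[dup] DD [X /inj_f ->].
by apply: (nD); exists D.
Qed.

Lemma hard_of_down_degree (n : nat) (R : graph_property) :
    (forall E,
      (forall x, minn n x <= count (fun z => `[< E [fset x; z] >]) (iota 0 x)) ->
      R E) ->
    (forall E x, R E -> exists y, adj E x y) ->
  hard R F_omega.
Proof.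
move=> R_dense R_nbr [s [s_legal s_wins]].
(* The stages are subsets of the type of moves, so a play that never terminates would contradict
   Cantor's theorem. *)
have [le le_wo] := well_ordering_principle (set {fset nat} : choiceType).
have [|p [fp tp [lowG highG]]] := terminal_run (le_wo := le_wo) (n := n) s_legal.
  apply: contrapT => nt.
  have inj_moves : injective (fun i => s (past le_wo s n i)).
    by apply: moves_inj s_legal _ => i ti; apply: nt; exists i.
  exact: no_injective_set inj_moves.
apply: (s_wins p fp tp).
move: (pos (final p)) tp lowG highG => G tG lowG highG.
set E := edges G; set N := nonedges G.
have RE : R E.
  case: tG => [all_R|none_R].
    by apply: all_R; split=> //; [exact: edges_pairs|exact: edges_nonedges].
  (* The largest extension has the property by the lower bounds on [down]. *)
  case: (none_R (pairs setT `\` N)).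
    split=> [e []//|e Ee|]; last by rewrite setDKI.
    split; first exact: edges_pairs Ee.
    by move=> Ne; have : set0 e; [rewrite -(edges_nonedges G)|].
  apply: R_dense => x; apply: leq_trans (lowG x) _.
  apply: sub_in_count => z; rewrite mem_iota => /= zx /asboolP Nz.
  by apply/asboolP; split=> //; apply/pairsP; exists x, z.
pose W : set nat := [set x | exists2 y, y < x & E [fset x; y]].
have infW : infinite_set W.
  (* The larger endpoint of an edge at [M.+1] lies in [W] and exceeds [M]. *)
  apply/infinite_unboundedP => M; have [y Exy] := R_nbr E M.+1 RE.
  have [yx|xy|xy] := ltngtP y M.+1.
  - by exists M.+1 => //; exists y.
  - exists y; last exact: ltnW.
    by exists M.+1 => //; rewrite fsetUC.
  - have [+ _] := edges_pairs Exy; by rewrite xy cardfs2 eqxx.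
(* The sparse graph consists of the undetermined pairs; these are among the non-nonedges, at most
   [n] of which go down from a vertex of [W]. *)
have [|V [infV VW indepV]] := @sparse_independent n
    (fun x y => ~ determined G [fset x; y]) W infW.
  move=> x [y yx /(highG _ _ yx)]; apply: leq_trans.
  apply: sub_count => z /asboolP[_ nd]; apply/asboolP => Nz.
  by apply: nd; right.
split.
  by move=> e [/edges_pairs|/nonedges_pairs].
exists V; split=> // e [e2 eV].
have [x [y [yx eE]]] : exists x y, y < x /\ e = [fset x; y] by apply/pairsP.
rewrite eE; apply: contrapT; apply: indepV => //; apply: eV.
  by rewrite eE !inE eqxx.
by rewrite eE !inE eqxx orbT.
Qed.

(** * The criterion applied to degrees and to component sizes *)

Theorem theorem4p12 :
  (forall n : nat, 1 <= n -> hard (D_ n) F_omega) /\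
  (forall m : nat, 2 <= m -> hard (C_ m) F_omega).
Proof.
split=> [n n1|m m2].
  apply: (@hard_of_down_degree n) => [E downE x|E x DE]; last first.
    apply: contrapT => noy; have := DE x.
    have -> : [set y | adj E x y] = set0.
      by rewrite -subset0 => y Exy; apply: noy; exists y.
    by move=> /card_le0P /seteqP[/(_ 0) + _]; apply.
  have [nx|xn] := leqP n x.
    apply: (@uniq_card_le _ [seq z <- iota 0 x | `[< E [fset x; z] >]]).
    - exact/filter_uniq/iota_uniq.
    - by rewrite size_filter; apply: leq_trans (downE x); rewrite leq_min leqnn.
    - by move=> z; rewrite mem_filter => /andP[/asboolP].
  (* For [a <= n] the bound [minn n a] is [a], so all smaller vertices are neighbours. The vertices
     up to [n] thus form a clique of size [n.+1], giving [x] its [n] neighbours. *)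
  have full a b : a <= n -> b < a -> E [fset a; b].
    move=> an ba; have := downE a; rewrite (minn_idPr an) => le_a.
    have : all (fun z => `[< E [fset a; z] >]) (iota 0 a).
      by rewrite all_count eqn_leq count_size size_iota.
    by move=> /allP /(_ b); rewrite mem_iota => /(_ ba) /asboolP.
  apply: (@uniq_card_le _ (rem x (iota 0 n.+1))).
  - exact/rem_uniq/iota_uniq.
  - by rewrite size_rem ?size_iota // mem_iota; lia.
  - move=> z; rewrite (mem_rem_uniq _ (iota_uniq _ _)) inE => /andP[zx].
    rewrite mem_iota add0n ltnS /adj => /= zn.
    have [zx'|xz|/eqP] := ltngtP z x; last by rewrite (negPf zx).
      by apply: full => //; exact: ltnW.
    by rewrite fsetUC; apply: full.
apply: (@hard_of_down_degree 1) => [E downE x|E x CE]; last first.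
  apply: contrapT => noy; have := CE x.
  (* An isolated vertex is alone in its component, which is too small since [m] is at least 2. *)
  have /subset_card_le /[swap] /card_le_trans /[apply] : component E x `<=` [set x].
    move=> y /clos_rt_rt1n_iff xy; case: xy noy => // z w xz _ [].
    by exists z.
  by rewrite (card_le_eqr card_set1) card_le_II leqNgt m2.
have adjC a b : adj E a b -> adj E b a by rewrite /adj fsetUC.
(* With [n = 1] every positive vertex has a smaller neighbour; descending reaches 0, so the graph is
   connected. *)
have to0 a : clos_refl_trans nat (adj E) a 0 /\ clos_refl_trans nat (adj E) 0 a.
  elim/ltn_ind: a => a IHa; have [->|a0] := posnP a; first by split; exact: rt_refl.
  have := downE a; rewrite (minn_idPl a0) -has_count => /hasP[b].
  rewrite mem_iota => /= ba /asboolP Eab; have [b0 b0'] := IHa b ba.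
  split; [apply: rt_trans b0; exact: rt_step|apply: rt_trans b0' _].
  exact/rt_step/adjC.
apply: (@uniq_card_le _ (iota 0 m)); rewrite ?iota_uniq ?size_iota // => y _.
exact: rt_trans (to0 x).1 (to0 y).2.
Qed.
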